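(* Let $\mathbb{F}$ be a field, $n\ge2$, and $\omega\in\mathbb{F}$ a primitive $n$th root of unity. Let $u:T_n(\omega)\to M_m(\mathbb{F})$ define an inner action of the Taft algebra $T_n(\omega)$ on $M_m(\mathbb{F})$, chosen so that $u(g)u(x)=\omega u(x)u(g)$, and suppose that $u(x)$ is nonsingular. Then $d=\frac{m}{n}$ is an integer and there exists $\alpha\in\mathbb{F}^\times$ such that the action is isomorphic to the inner action with $$u(g)=\begin{pmatrix}I_d&0&\cdots&0\\0&\omega I_d&\cdots&0\\ \vdots&&\ddots&\vdots\\0&0&\cdots&\omega^{n-1}I_d\end{pmatrix},\qquad u(x)=\begin{pmatrix}0&0&\cdots&0&\alpha I_d\\ I_d&0&\cdots&0&0\\0&I_d&\cdots&0&0\\ \vdots&&\ddots&&\vdots\\0&0&\cdots&I_d&0\end{pmatrix}.$$ Two actions with different values of $\alpha$ are not isomorphic.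
   Context: The Taft algebra $T_n(\omega)$ is the $n^2$-dimensional Hopf algebra generated by $g,x$ with $g^n=1$, $x^n=0$, $gx=\omega xg$, $\Delta(g)=g\otimes g$, $\Delta(x)=x\otimes1+g\otimes x$, $\varepsilon(g)=1$, $\varepsilon(x)=0$. An action of a Hopf algebra $H$ on $A$ is an $H$-module algebra structure; two actions $*,\circ$ are isomorphic if there is an algebra automorphism $\varphi$ of $A$ with $h\circ\varphi(a)=\varphi(h*a)$ for all $h,a$. An action is inner, via a convolution invertible linear map $u:H\to A$ with $u(1)=1_A$, if $h*a=\sum u(h_{(1)})au^{-1}(h_{(2)})$, where $u^{-1}$ is the convolution inverse; for the Taft algebra this means $g*a=u(g)au(g)^{-1}$ and $x*a=u(x)a-u(g)au(g)^{-1}u(x)$. Every action on a matrix algebra is inner and $u$ can be chosen so that $u(g)u(x)=\omega u(x)u(g)$.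
   Formalization: Existence of α and of the isomorphism is proved only when u(g)^n = c^n I for some c in F (automatic for algebraically closed F); without this the claim fails, e.g. over Q with n=m=2, u(g)=[[0,-1],[1,0]], u(x)=diag(1,-1). Also m ≥ 1 is assumed. *)

(* Defs.v *)
From HB Require Import structures.
From mathcomp Require Import all_boot all_order all_algebra.

Set Implicit Arguments.
Unset Strict Implicit.
Unset Printing Implicit Defensive.

Import GRing.Theory.
Local Open Scope ring_scope.

(* The vector space F^B with basis indexed by the finite type B; the tensor   *)
(* product of F^B and F^C is F^(B * C).                                       *)
Definition fvect (F : fieldType) (B : finType) := {ffun B -> F^o}.
HB.instance Definition _ (F : fieldType) (B : finType) :=
  GRing.Lmodule.on (fvect F B).

Section FreeVectorSpaces.
Variable F : fieldType.

Definition bvect (B : finType) (b : B) : fvect F B :=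
  [ffun c => (c == b)%:R].

Definition tens (B C : finType) (v : fvect F B) (w : fvect F C) :
    fvect F (B * C)%type :=
  [ffun p : B * C => (v p.1 : F) * w p.2].

Definition lin_ext (B : finType) (V : lmodType F) (f : B -> V)
    (v : fvect F B) : V :=
  \sum_(b : B) (v b : F) *: f b.

Definition bilin_ext (B C : finType) (V : lmodType F) (f : B -> C -> V)
    (v : fvect F B) (w : fvect F C) : V :=
  \sum_(b : B) \sum_(c : C) ((v b : F) * w c) *: f b c.

End FreeVectorSpaces.

Arguments bvect {F B} b.

(* The Taft algebra T_n(w), on its basis (g^i x^j)_{0 <= i, j < n}; the pair  *)
(* (i, j) indexes g^i x^j.                                                    *)
Notation taft_index n := ('I_n * 'I_n)%type.
Notation taft F n := (fvect F (taft_index n)).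
Notation taft2 F n := (fvect F (taft_index n * taft_index n)%type).

Section Taft.
Variables (F : fieldType) (n : nat) (w : F).

(* g^i x^j for arbitrary i and j, using g^n = 1 and x^n = 0. *)
Definition taft_mon (i j : nat) : taft F n :=
  [ffun p : taft_index n => ((p.1 == (i %% n)%N :> nat) && (p.2 == j :> nat))%:R].

Definition taft_1 : taft F n := taft_mon 0 0.
Definition taft_g : taft F n := taft_mon 1 0.
Definition taft_x : taft F n := taft_mon 0 1.

(* (g^i x^j) (g^k x^l) = w^(-jk) g^(i+k) x^(j+l), as x g = w^-1 g x. *)
Definition taft_mulb (p q : taft_index n) : taft F n :=
  (w ^- (p.2 * q.1)%N) *: taft_mon (p.1 + q.1) (p.2 + q.2).

Definition taft_mul : taft F n -> taft F n -> taft F n :=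
  bilin_ext taft_mulb.

Definition taft2_1 : taft2 F n := tens taft_1 taft_1.

(* (a (x) b) (c (x) d) = ac (x) bd. *)
Definition taft2_mul : taft2 F n -> taft2 F n -> taft2 F n :=
  bilin_ext (fun p q => tens (taft_mulb p.1 q.1) (taft_mulb p.2 q.2)).

Definition taft_comul_g : taft2 F n := tens taft_g taft_g.
Definition taft_comul_x : taft2 F n := tens taft_x taft_1 + tens taft_g taft_x.

(* Delta is the multiplicative map with the above values on g and x:          *)
(* Delta(g^i x^j) = Delta(g)^i Delta(x)^j.                                    *)
Definition taft_comul : taft F n -> taft2 F n :=
  lin_ext (fun p : taft_index n =>
    iter p.1 (taft2_mul taft_comul_g)
      (iter p.2 (taft2_mul taft_comul_x) taft2_1)).

Definition taft_counit : taft F n -> F^o :=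
  lin_ext (fun p : taft_index n => (p.2 == 0%N :> nat)%:R : F^o).

(* sum f h_(1) h_(2), for f bilinear. *)
Definition sweedler (V : lmodType F) (f : taft F n -> taft F n -> V)
    (h : taft F n) : V :=
  lin_ext (fun p => f (bvect p.1) (bvect p.2)) (taft_comul h).

Variable A : algType F.

Record is_action (act : taft F n -> A -> A) : Prop := IsAction {
  act_linearl : forall a, linear (act^~ a);
  act_linearr : forall h, linear (act h);
  act_one : forall a, act taft_1 a = a;
  act_mul : forall h k a, act (taft_mul h k) a = act h (act k a);
  act_unit : forall h, act h 1 = (taft_counit h : F) *: 1;
  act_prod : forall h a b,
    act h (a * b) = sweedler (fun h1 h2 => act h1 a * act h2 b) h
}.

Definition action_iso (act1 act2 : taft F n -> A -> A) : Prop :=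
  exists phi : {lrmorphism A -> A},
    bijective phi /\ forall h a, act2 h (phi a) = phi (act1 h a).

Definition convolution (u v : taft F n -> A) : taft F n -> A :=
  sweedler (fun h1 h2 => u h1 * v h2).

Definition convolution_inverse (u v : taft F n -> A) : Prop :=
  forall h, convolution u v h = (taft_counit h : F) *: 1 /\
            convolution v u h = (taft_counit h : F) *: 1.

Definition inner_action (act : taft F n -> A -> A)
    (u : {linear taft F n -> A}) : Prop :=
  [/\ is_action act, u taft_1 = 1 &
   exists2 v : {linear taft F n -> A}, convolution_inverse u v &
     forall h a, act h a = sweedler (fun h1 h2 => u h1 * a * v h2) h].

End Taft.

Arguments taft_1 {F n}.
Arguments taft_g {F n}.
Arguments taft_x {F n}.

Section StandardActions.
Variables (F : fieldType) (n : nat) (w : F) (k : nat).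

(* The m x m matrix, m = k+1 = n d, whose (r, s) block (0 <= r, s < n), of    *)
(* size d x d, is the scalar matrix c r s.                                    *)
Definition scalar_blocks (d : nat) (c : nat -> nat -> F) : 'M[F]_k.+1 :=
  \matrix_(i, j) (c (i %/ d)%N (j %/ d)%N * ((i %% d == j %% d)%N)%:R).

Definition standard_g (d : nat) : 'M[F]_k.+1 :=
  scalar_blocks d (fun r s => if r == s then w ^+ r else 0).

Definition standard_x (d : nat) (alpha : F) : 'M[F]_k.+1 :=
  scalar_blocks d (fun r s =>
    if r == s.+1 then 1
    else if (r == 0%N) && (s == n.-1) then alpha else 0).

Definition standard_action (d : nat) (alpha : F)
    (act : taft F n -> 'M[F]_k.+1 -> 'M[F]_k.+1) : Prop :=
  exists u : {linear taft F n -> 'M[F]_k.+1},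
    [/\ inner_action w act u, u taft_g = standard_g d
      & u taft_x = standard_x d alpha].

End StandardActions.

(* Main.v *)
Require Import Defs.
From HB Require Import structures.
From mathcomp Require Import all_boot all_order all_algebra.

(* Write G = u(g), X = u(x) and tau(a) = G a G^-1, so that x acts by
   D(a) = X a - tau(a) X. As tau(X) = w X, the iterate D^r(a) is the sum over j
   of p_j X^j tau^(r-j)(a) X^(r-j), where p = prod_(i < r) ('X - w^i). For r = n
   this p is 'X^n - 1 and tau^n = 1, so D^n = 0 makes X^n central.
   Once G is rescaled so that G^n = 1, the mean E of the powers of G is the
   projection to the eigenvalue 1 and X^r E X^-r is the one to w^r; if B is a row
   basis of E, then the rows of B, B X^-1, ..., B X^-(n-1) form a basis in which
   (G, X) is standard. Rescaling G by c^-1 keeps the action: it replaces u by its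
   convolution product with the functional g^i x^j |-> c^-i [j = 0].
   For the last claim Skolem-Noether is not needed: an isomorphism phi satisfies
   phi(X1) = X2, because Z = phi(X1) - X2 satisfies Z b = tau(b) Z for all b
   and tau(Z) = w Z; then X1^n = alpha and X2^n = beta give alpha = beta. *)

Set Implicit Arguments.
Unset Strict Implicit.
Unset Printing Implicit Defensive.

Import GRing.Theory.
Local Open Scope ring_scope.

(** * Linear and bilinear extension from a basis *)

Section FreeVectorSpaceTheory.
Variable F : fieldType.

Lemma lin_ext_linear (B : finType) (V : lmodType F) (f : B -> V) :
  linear (lin_ext f).
Proof.
move=> a v w; rewrite /lin_ext scaler_sumr -big_split; apply: eq_bigr => b _.
by rewrite /= scalerA -scalerDl !ffunE.
Qed.

Lemma lin_ext_bvect (B : finType) (V : lmodType F) (f : B -> V) b :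
  lin_ext f (bvect b) = f b.
Proof.
rewrite /lin_ext (bigD1 b) //= big1 => [|c cb]; rewrite ffunE ?eqxx ?scale1r ?addr0 //.
by rewrite (negPf cb) scale0r.
Qed.

Lemma lin_ext_comp (B : finType) (V W : lmodType F) (f : B -> V)
  (g : {linear V -> W}) v : g (lin_ext f v) = lin_ext (g \o f) v.
Proof. by rewrite linear_sum; apply: eq_bigr => b _; rewrite linearZ. Qed.

Lemma linear_lin_ext (B : finType) (V : lmodType F) (f : fvect F B -> V) v :
  linear f -> f v = lin_ext (f \o bvect) v.
Proof.
move=> f_lin; have fE : v = \sum_b (v b : F) *: bvect b.
  apply/ffunP => c; rewrite sum_ffunE (bigD1 c) //= big1 => [|b bc]; rewrite !ffunE.
    by rewrite eqxx addr0 /= [RHS]mulr1.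
  by rewrite eq_sym (negPf bc) /= [LHS]mulr0.
pose fL : {linear _ -> _} := HB.pack f (GRing.isLinear.Build _ _ _ _ f f_lin).
by rewrite {1}fE -[f]/(fL : _ -> _) linear_sum; apply: eq_bigr => b _; rewrite linearZ.
Qed.

Lemma bilin_ext_bvect (B C : finType) (V : lmodType F) (f : B -> C -> V) b c :
  bilin_ext f (bvect b) (bvect c) = f b c.
Proof.
rewrite /bilin_ext (bigD1 b) //= (bigD1 c) //= big1 => [|c' /negPf cc'].
  rewrite big1 => [|b' /negPf bb']; first by rewrite !ffunE !eqxx mulr1 scale1r !addr0.
  by rewrite big1 // => c' _; rewrite !ffunE bb' mul0r scale0r.
by rewrite !ffunE cc' mulr0 scale0r.
Qed.

Lemma tens_bvect (B C : finType) (b : B) (c : C) :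
  tens (bvect b) (bvect c) = bvect (b, c) :> fvect F _.
Proof.
apply/ffunP => -[b' c']; rewrite !ffunE /= xpair_eqE.
by case: eqP => _; case: eqP => _; rewrite ?mulr1 ?mul0r ?mulr0.
Qed.

End FreeVectorSpaceTheory.

(** * Products and coproduct supports in the Taft algebra *)

Section TaftTheory.
Variables (F : fieldType) (n : nat) (w : F).
Local Notation T := (taft F n).
Local Notation T2 := (taft2 F n).
Local Notation idx := (taft_index n).

Lemma taft_mon_bvect (i j : 'I_n) : taft_mon F n i j = bvect (i, j).
Proof.
by apply/ffunP => -[i' j']; rewrite !ffunE /= modn_small // xpair_eqE !val_eqE.
Qed.

Lemma taft_mul_mon (i j k l : nat) : (j < n)%N -> (l < n)%N ->
  taft_mul w (taft_mon F n i j) (taft_mon F n k l) =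
  w ^- (j * (k %% n))%N *: taft_mon F n (i + k) (j + l).
Proof.
move=> jn ln; have n_gt0 := leq_ltn_trans (leq0n j) jn.
have monE i' j' (j'n : (j' < n)%N) :
    taft_mon F n i' j' = bvect (Ordinal (ltn_pmod i' n_gt0), Ordinal j'n).
  rewrite -taft_mon_bvect; apply/ffunP => p; rewrite !ffunE /= modn_mod //.
rewrite (monE i _ jn) (monE k _ ln) /taft_mul bilin_ext_bvect /taft_mulb /=.
by congr (_ *: _); apply/ffunP => p; rewrite !ffunE modnDm.
Qed.

(* The coproduct is homogeneous for these conditions on the support, and this
   is all that is used of it: its q-binomial coefficients never matter. *)
Definition comul_degree (i j : nat) (v : T2) : Prop :=
  forall p q : idx, v (p, q) != 0 ->
    [/\ q.1 = i %[mod n], (p.2 + q.2 = j)%N & p.1 = q.1 + q.2 %[mod n]].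

Lemma natb_neq0 (b : bool) : (b%:R != 0 :> F) = b.
Proof. by case: b; rewrite ?oner_eq0 ?eqxx. Qed.

Lemma taft_mon_neq0 i j (p : idx) :
  taft_mon F n i j p != 0 -> p.1 = (i %% n)%N :> nat /\ p.2 = j :> nat.
Proof.
by rewrite ffunE; case: andP => [[/eqP-> /eqP->] //|]; rewrite eqxx.
Qed.

Lemma comul_degree_tens_mon i j i' j' :
  i = i' + j' %[mod n] ->
  comul_degree i' (j + j') (tens (taft_mon F n i j) (taft_mon F n i' j')).
Proof.
move=> ii' p q; rewrite ffunE /= mulf_eq0 negb_or.
case/andP=> /taft_mon_neq0[pi ->] /taft_mon_neq0[qi qj].
by rewrite pi qi qj !modn_mod modnDml ii'.
Qed.

Lemma sum_neq0_exists (V : zmodType) (I : finType) (f : I -> V) :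
  \sum_i f i != 0 -> exists i, f i != 0.
Proof.
move=> s0; apply/existsP; apply: contraNT s0; rewrite negb_exists => /forallP f0.
by rewrite big1 // => i _; apply/eqP; rewrite -[_ == _]negbK f0.
Qed.

(** Multiplying basis monomials adds exponents, modulo [n] for g and exactly for x, and all three
    conditions are additive. *)
Lemma comul_degree_mul i j i' j' v v' :
  comul_degree i j v -> comul_degree i' j' v' ->
  comul_degree (i + i') (j + j') (taft2_mul w v v').
Proof.
move=> dv dv' p q; rewrite /taft2_mul /bilin_ext sum_ffunE.
case/sum_neq0_exists => -[a b]; rewrite sum_ffunE => /sum_neq0_exists [[c d]].
rewrite !ffunE !(scaler_eq0, mulf_eq0, negb_or) /= !natb_neq0.
case/andP=> /andP[/dv [bi abj ab] /dv' [di cdj cd]].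
case/andP=> /andP[_ /andP[/eqP p1 /eqP p2]] /andP[_ /andP[/eqP q1 /eqP q2]].
rewrite p1 p2 q1 q2 !modn_mod modnDml; split.
- by rewrite -modnDm bi di modnDm.
- by rewrite -abj -cdj addnACA.
- by rewrite -modnDm ab cd modnDm addnACA.
Qed.

(** The elements Delta(g) = g (x) g and Delta(x) = x (x) 1 + g (x) x are homogeneous of degrees (1,
    0) and (0, 1); products of them follow by induction. *)
Lemma taft_comul_degree (b : idx) :
  comul_degree b.1 b.2 (taft_comul w (bvect b)).
Proof.
rewrite /taft_comul lin_ext_bvect.
have deg1 : comul_degree 0 0 (taft2_1 F n) by exact: comul_degree_tens_mon.
have degg : comul_degree 1 0 (taft_comul_g F n).
  by apply: (@comul_degree_tens_mon 1 0 1 0).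
have degx : comul_degree 0 1 (taft_comul_x F n).
  move=> p q; rewrite ffunE => pq0.
  case: (eqVneq (tens (taft_x : T) taft_1 (p, q)) 0) => [x0|].
    by apply: (@comul_degree_tens_mon 1 0 0 1) => //; move: pq0; rewrite x0 add0r.
  by apply: (@comul_degree_tens_mon 0 1 0 0).
elim: (nat_of_ord b.1) => [|i IHi]; last first.
  by rewrite iterS; apply: (@comul_degree_mul 1 0 i b.2).
elim: (nat_of_ord b.2) => [|j IHj] //.
by rewrite iterS; apply: (@comul_degree_mul 0 1 0 j).
Qed.

Lemma taft_comul_linear : linear (taft_comul w : T -> T2).
Proof. exact: lin_ext_linear. Qed.

(** The third degree condition does not mention [i] and [j], so it passes from basis elements to
    every [h]. It is what makes the scalars cancel in [inner_action_twist]. *)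
Lemma taft_comul_support (h : T) (p q : idx) :
  taft_comul w h (p, q) != 0 -> p.1 = ((q.1 + q.2) %% n)%N :> nat.
Proof.
rewrite (linear_lin_ext _ taft_comul_linear) /lin_ext sum_ffunE.
case/sum_neq0_exists => b; rewrite ffunE scaler_eq0 negb_or => /andP[_].
by case/taft_comul_degree => _ _; rewrite modn_small.
Qed.

Lemma sweedler_linear (V : lmodType F) (f : T -> T -> V) : linear (sweedler w f).
Proof. by move=> a h k; rewrite /sweedler taft_comul_linear lin_ext_linear. Qed.

Lemma eq_sweedler (V : lmodType F) (f f' : T -> T -> V) h :
  (forall p q, taft_comul w h (p, q) != 0 ->
     f (bvect p) (bvect q) = f' (bvect p) (bvect q)) ->
  sweedler w f h = sweedler w f' h.
Proof.
move=> ff'; apply: eq_bigr => -[p q] _ /=.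
have [->|/ff' ->] := eqVneq (taft_comul w h (p, q)) 0; first by rewrite !scale0r.
by [].
Qed.

Lemma sweedler_comp (V W : lmodType F) (f : T -> T -> V) (g : {linear V -> W}) h :
  g (sweedler w f h) = sweedler w (fun h1 h2 => g (f h1 h2)) h.
Proof. exact: lin_ext_comp. Qed.

End TaftTheory.

(** * Coproduct and counit on the generators *)

Section TaftGenerators.
Variables (F : fieldType) (n' : nat) (w : F).
Local Notation n := n'.+2.
Local Notation T := (taft F n).
Local Notation T2 := (taft2 F n).
Local Notation idx := (taft_index n).

Let b1 : idx := (ord0, ord0).
Let bg : idx := (inord 1, ord0).
Let bx : idx := (ord0, inord 1).

(** The shape [n'.+2] makes 1 a valid index, so that [bg] and [bx] really index g and x. *)
Let val_inord1 : (inord 1 : 'I_n) = 1%N :> nat. Proof. by rewrite inordK. Qed.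

Lemma taft_1_bvect : taft_1 = bvect b1 :> T.
Proof. by rewrite -taft_mon_bvect. Qed.

Lemma taft_g_bvect : taft_g = bvect bg :> T.
Proof. by rewrite -taft_mon_bvect val_inord1. Qed.

Lemma taft_x_bvect : taft_x = bvect bx :> T.
Proof. by rewrite -taft_mon_bvect val_inord1. Qed.

Lemma taft_mulb_1r (p : idx) : taft_mulb w p b1 = bvect p.
Proof.
by rewrite /taft_mulb muln0 expr0 invr1 scale1r !addn0 taft_mon_bvect -surjective_pairing.
Qed.

Lemma taft2_mul_1r (p q : idx) :
  taft2_mul w (bvect (p, q)) (taft2_1 F n) = bvect (p, q).
Proof.
rewrite /taft2_1 taft_1_bvect tens_bvect /taft2_mul bilin_ext_bvect /=.
by rewrite !taft_mulb_1r tens_bvect.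
Qed.

Lemma taft_comul_1 : taft_comul w (taft_1 : T) = bvect (b1, b1).
Proof.
by rewrite taft_1_bvect /taft_comul lin_ext_bvect /= /taft2_1 taft_1_bvect tens_bvect.
Qed.

Lemma taft_comul_gE : taft_comul w (taft_g : T) = bvect (bg, bg).
Proof.
rewrite taft_g_bvect /taft_comul lin_ext_bvect /= val_inord1 /=.
by rewrite /taft_comul_g taft_g_bvect tens_bvect taft2_mul_1r.
Qed.

Lemma taft_comul_xE :
  taft_comul w (taft_x : T) = bvect (bx, b1) + bvect (bg, bx).
Proof.
rewrite taft_x_bvect /taft_comul lin_ext_bvect /= val_inord1 /=.
rewrite /taft_comul_x taft_g_bvect taft_x_bvect taft_1_bvect !tens_bvect.
(* Both terms on the right become products with [taft2_1], so that additivity of [taft2_mul] in its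
   first argument concludes. *)
rewrite -[X in _ = X + _]taft2_mul_1r -[X in _ = _ + X]taft2_mul_1r.
rewrite /taft2_mul /bilin_ext -big_split; apply: eq_bigr => p _.
rewrite -big_split; apply: eq_bigr => q _.
by rewrite /= -scalerDl -mulrDl ffunE.
Qed.

Variables (V : lmodType F) (f : T -> T -> V).

Lemma sweedler_1 : sweedler w f taft_1 = f taft_1 taft_1.
Proof. by rewrite /sweedler taft_comul_1 lin_ext_bvect /= -taft_1_bvect. Qed.

Lemma sweedler_g : sweedler w f taft_g = f taft_g taft_g.
Proof. by rewrite /sweedler taft_comul_gE lin_ext_bvect /= -taft_g_bvect. Qed.

Lemma sweedler_x : sweedler w f taft_x = f taft_x taft_1 + f taft_g taft_x.
Proof.
rewrite /sweedler taft_comul_xE -[X in lin_ext _ (X + _)]scale1r lin_ext_linear.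
by rewrite scale1r !lin_ext_bvect /= -taft_1_bvect -taft_g_bvect -taft_x_bvect.
Qed.

Lemma taft_counit_1 : taft_counit (taft_1 : T) = 1.
Proof. by rewrite taft_1_bvect /taft_counit lin_ext_bvect. Qed.

Lemma taft_counit_g : taft_counit (taft_g : T) = 1.
Proof. by rewrite taft_g_bvect /taft_counit lin_ext_bvect. Qed.

Lemma taft_counit_x : taft_counit (taft_x : T) = 0.
Proof. by rewrite taft_x_bvect /taft_counit lin_ext_bvect /= val_inord1. Qed.

End TaftGenerators.

(** * Inner actions and the rescaling of u(g) *)

Section Actions.
Variables (F : fieldType) (n' : nat) (w : F) (A : algType F).
Local Notation n := n'.+2.
Local Notation T := (taft F n).

(** Iterating the action of x is acting by x^r, and x^n = 0: no basis index has second component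
    [n]. *)
Lemma action_iter_x (act : T -> A -> A) a :
  is_action w act -> iter n (act taft_x) a = 0.
Proof.
move=> act_ok; have iterE r : (r <= n)%N ->
    iter r (act taft_x) a = act (taft_mon F n 0 r) a.
  elim: r => [_|r IHr rn] /=; first by rewrite (act_one act_ok).
  rewrite IHr 1?ltnW // -(act_mul act_ok) taft_mul_mon //.
  by rewrite muln0 expr0 invr1 scale1r add1n.
rewrite iterE // (_ : taft_mon F n 0 n = 0) => [|].
  by have := act_linearl act_ok a (-1) 0 0; rewrite scaler0 addr0 scaleN1r addNr.
by apply/ffunP => p; rewrite !ffunE (ltn_eqF (ltn_ord p.2)) andbF.
Qed.

(** The convolution identities at g, 1 and x give in turn v(g) = u(g)^-1, v(1) = 1 and v(x) = -
    u(g)^-1 u(x). *)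
Lemma inner_action_gx (act : T -> A -> A) (u : {linear T -> A}) :
  inner_action w act u ->
  exists2 gi : A, u taft_g * gi = 1 /\ gi * u taft_g = 1 &
    (forall a, act taft_g a = u taft_g * a * gi) /\
    (forall a, act taft_x a = u taft_x * a - u taft_g * a * gi * u taft_x).
Proof.
case=> _ u1 [v uv actE]; exists (v taft_g).
  have [] := uv taft_g; rewrite /convolution !sweedler_g.
  by rewrite taft_counit_g scale1r.
have v1 : v taft_1 = 1.
  have [+ _] := uv taft_1; rewrite /convolution sweedler_1 u1 mul1r.
  by rewrite taft_counit_1 scale1r.
have vx : v taft_x = - (v taft_g * u taft_x).
  have [_] := uv taft_x; rewrite /convolution sweedler_x u1 mulr1.
  by rewrite taft_counit_x scale0r => /eqP; rewrite addr_eq0 => /eqP.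
split=> a; rewrite actE ?sweedler_g // sweedler_x v1 mulr1 vx mulrN.
by rewrite mulrA.
Qed.

Section Twist.
Variables (act : T -> A -> A) (u : {linear T -> A}) (c : F).

(* The convolution product of u with the functional g^i x^j |-> c^-i [j = 0],
   and that of the inverse functional with v: the term of Delta(g^i x^j) whose
   first leg has no x is g^(i+j) (x) g^i x^j, hence the exponent (i + j) mod n. *)
Definition twist := lin_ext (fun p : taft_index n => c ^- p.1 *: u (bvect p)).
HB.instance Definition _ := GRing.isLinear.Build F T A _ twist
  (lin_ext_linear (fun p : taft_index n => c ^- p.1 *: u (bvect p))).

Definition cotwist (v : {linear T -> A}) :=
  lin_ext (fun p : taft_index n => c ^+ ((p.1 + p.2) %% n)%N *: v (bvect p)).
HB.instance Definition _ v := GRing.isLinear.Build F T A _ (cotwist v)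
  (lin_ext_linear (fun p : taft_index n => c ^+ ((p.1 + p.2) %% n)%N *: v (bvect p))).

Lemma twist_bvect p : twist (bvect p) = c ^- p.1 *: u (bvect p).
Proof. exact: lin_ext_bvect. Qed.

Lemma twist_mon i j : (i < n)%N -> (j < n)%N ->
  twist (taft_mon F n i j) = c ^- i *: u (taft_mon F n i j).
Proof.
move=> i_n j_n.
by rewrite [taft_mon F n i j](taft_mon_bvect F (Ordinal i_n) (Ordinal j_n)) twist_bvect.
Qed.

Lemma cotwist_bvect v p :
  cotwist v (bvect p) = c ^+ ((p.1 + p.2) %% n)%N *: v (bvect p).
Proof. exact: lin_ext_bvect. Qed.

Hypothesis c_neq0 : c != 0.

Lemma inner_action_twist : inner_action w act u -> inner_action w act twist.
Proof.
case=> act_ok u1 [v uv actE].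
(* On the support of the coproduct the two scalars are mutually inverse; this settles one side of
   the convolution inverse and the action formula. *)
have cancel (h : T) p q (pq : taft_comul w h (p, q) != 0) :
    c ^- p.1 * c ^+ ((q.1 + q.2) %% n)%N = 1.
  by rewrite -(taft_comul_support pq) mulVf ?expf_neq0.
split=> //; first by rewrite [LHS]twist_mon // expr0 invr1 scale1r.
exists (cotwist v) => [h|h a].
  split.
    rewrite -(proj1 (uv h)); apply: eq_sweedler => p q pq.
    rewrite /= twist_bvect cotwist_bvect -scalerAl -scalerAr scalerA.
    by rewrite (cancel h) // scale1r.
  rewrite /convolution.
  have counit_lin : linear (fun h : T => (taft_counit h : F) *: (1 : A)).
    by move=> a h1 h2; rewrite /taft_counit lin_ext_linear scalerDl scalerA.
  rewrite (linear_lin_ext _ (sweedler_linear w (fun h1 h2 : T =>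
    cotwist v h1 * twist h2))) [RHS](linear_lin_ext _ counit_lin).
  apply: eq_bigr => b _; congr (_ *: _) => /=.
  (* In the other order the scalars do not cancel, but on Delta(g^i x^j) their product is constant
     by homogeneity. The counit then leaves only j = 0, where this constant is 1. *)
  transitivity ((c ^+ ((b.1 + b.2) %% n)%N * c ^- b.1) *: convolution w v u (bvect b)).
    rewrite /convolution -[RHS]/(( *:%R _ : {linear A -> A}) _) sweedler_comp.
    apply: eq_sweedler => p q pq; rewrite /= twist_bvect cotwist_bvect.
    rewrite -scalerAl -scalerAr scalerA /=; congr (_ * _ *: _).
      have [qb pqb pE] := taft_comul_degree pq.
      by rewrite -modnDml pE modnDml -addnA (addnC q.2) pqb -modnDml qb modnDml.
    by case: (taft_comul_degree pq) => + _ _; rewrite !modn_small // => ->.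
  rewrite (proj2 (uv _)) /taft_counit lin_ext_bvect /=.
  case: eqP => [->|_]; last by rewrite !scale0r scaler0.
  by rewrite addn0 modn_small // mulfV ?expf_neq0 // scale1r.
rewrite actE; apply: eq_sweedler => p q pq.
rewrite /= twist_bvect cotwist_bvect -!scalerAl -scalerAr scalerA.
by rewrite (cancel h) // scale1r.
Qed.

End Twist.
End Actions.

(** * Elements commuting up to a scalar, and idempotents *)

Section SkewCommutation.
Variables (F : fieldType) (A : algType F) (w : F) (a b : A).
Hypothesis ab : a * b = w *: (b * a).

Lemma skew_exprr r : a * b ^+ r = w ^+ r *: (b ^+ r * a).
Proof.
elim: r => [|r IHr]; first by rewrite !expr0 mulr1 mul1r scale1r.
rewrite exprSr mulrA IHr -scalerAl -(mulrA _ a b) ab -scalerAr scalerA mulrA.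
by rewrite -!exprSr.
Qed.

Lemma skew_exprl r : a ^+ r * b = w ^+ r *: (b * a ^+ r).
Proof.
elim: r => [|r IHr]; first by rewrite !expr0 mulr1 mul1r scale1r.
rewrite exprS -mulrA IHr -scalerAr (mulrA a b) ab -scalerAl scalerA -mulrA.
by rewrite -exprS -exprSr.
Qed.

End SkewCommutation.

Lemma mul_exprVr (R : pzRingType) (x y : R) r : x * y = 1 -> x ^+ r * y ^+ r = 1.
Proof.
move=> xy; elim: r => [|r IHr]; first by rewrite !expr0 mulr1.
by rewrite exprSr exprS -mulrA (mulrA x) xy mul1r.
Qed.

Lemma sum_expr_unity_root (R : idomainType) n (z : R) :
  z ^+ n = 1 -> \sum_(r < n) z ^+ r = if z == 1 then n%:R else 0.
Proof.
move=> zn; case: eqP => [->|/eqP z1].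
  by under eq_bigr do rewrite expr1n; rewrite sumr_const card_ord.
have := subrX1 z n; rewrite zn subrr => /esym/eqP.
by rewrite mulf_eq0 subr_eq0 (negPf z1) => /eqP.
Qed.

Section SkewIdempotent.
Variables (F : fieldType) (A : algType F) (n : nat) (w : F).
Hypothesis w_prim : n.-primitive_root w.
Variables (G X Y E : A).
Hypotheses (GX : G * X = w *: (X * G)) (XY : X * Y = 1) (YX : Y * X = 1).
Hypotheses (GE : G * E = E) (EG : E * G = E) (EE : E * E = E).

Lemma skewYG : Y * G = w *: (G * Y).
Proof.
by rewrite -[LHS]mulr1 -XY mulrA -(mulrA Y) GX -scalerAr -scalerAl mulrA YX mul1r.
Qed.

Lemma idem_skew r : E * Y ^+ r * G = w ^+ r *: (E * Y ^+ r).
Proof.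
by rewrite -mulrA (skew_exprl skewYG) -scalerAr mulrA EG.
Qed.

(** For [r != s], evaluate E Y^r G X^s E twice: moving G right into E gives the factor w^s, moving
    it left into E gives w^r, and these powers differ. *)
Lemma idem_ortho r s : (r < n)%N -> (s < n)%N ->
  E * Y ^+ r * X ^+ s * E = if r == s then E else 0.
Proof.
move=> rn sn; case: eqP => [<-|/eqP rs].
  by rewrite -(mulrA E) mul_exprVr // mulr1 EE.
set M := LHS.
have : w ^+ s *: M = w ^+ r *: M.
  transitivity (E * Y ^+ r * (w ^+ s *: (X ^+ s * G)) * E).
    by rewrite -scalerAr -scalerAl !mulrA -(mulrA _ G) GE.
  by rewrite -(skew_exprr GX) mulrA idem_skew -!scalerAl.
move/eqP; rewrite -subr_eq0 -scalerBl scaler_eq0 subr_eq0.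
by rewrite (eq_prim_root_expr w_prim) !modn_small // eq_sym (negPf rs) => /eqP.
Qed.

End SkewIdempotent.

(** * The projection to the eigenvalue 1 and its conjugates *)

Section EigenProjections.
Variables (F : fieldType) (A : algType F) (n : nat) (w : F).
Hypothesis w_prim : n.-primitive_root w.
Variables (G X Y : A).
Hypotheses (GX : G * X = w *: (X * G)) (XY : X * Y = 1) (YX : Y * X = 1).
Hypothesis Gn : G ^+ n = 1.

Definition eigen_proj : A := n%:R^-1 *: \sum_(j < n) G ^+ j.
Local Notation E := eigen_proj.

Let n_gt0 : (0 < n)%N. Proof. exact: prim_order_gt0 w_prim. Qed.
Let w_neq0 : w != 0.
Proof.
apply: contra_eq_neq (prim_expr_order w_prim) => ->.
by rewrite expr0n gtn_eqF // eq_sym oner_eq0.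
Qed.

Lemma eigen_proj_mull : G * E = E.
Proof.
rewrite /E -scalerAr mulr_sumr; congr (_ *: _).
under eq_bigr do rewrite -exprS.
case: n n_gt0 Gn => // n' _ Gn'.
by rewrite big_ord_recr big_ord_recl Gn' addrC expr0.
Qed.

Lemma eigen_proj_mulr : E * G = E.
Proof.
rewrite -[RHS]eigen_proj_mull /E -scalerAl -scalerAr mulr_suml mulr_sumr.
by under eq_bigr do rewrite -exprSr exprS.
Qed.

Lemma eigen_proj_idem : E * E = E.
Proof.
rewrite {1}/E -scalerAl mulr_suml.
have GE j : G ^+ j * E = E.
  by elim: j => [|j IHj]; rewrite ?mul1r // exprSr -mulrA eigen_proj_mull.
under eq_bigr do rewrite GE.
rewrite sumr_const card_ord -scaler_nat scalerA mulVf ?scale1r //.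
(* A primitive [n]-th root of unity exists only if [n] is nonzero in [F]. *)
exact: prim_root_natf_neq0 w_prim.
Qed.

(** The [r]-th term is the mean over [j] of w^(-jr) G^j; summing over [r] kills every [j] except
    0. *)
Lemma eigen_proj_sum : \sum_(r < n) X ^+ r * E * Y ^+ r = 1.
Proof.
have XG : X * G = w^-1 *: (G * X) by rewrite GX scalerA mulVf ?scale1r.
have term r : X ^+ r * E * Y ^+ r =
    n%:R^-1 *: \sum_(j < n) (w ^- j) ^+ r *: G ^+ j.
  rewrite /E -scalerAr -scalerAl mulr_sumr mulr_suml; congr (_ *: _).
  apply: eq_bigr => j _; rewrite (skew_exprl (skew_exprr XG j)) -scalerAl.
  by rewrite -mulrA mul_exprVr // mulr1 (exprVn w).
under eq_bigr do rewrite term.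
rewrite -scaler_sumr exchange_big /=.
under eq_bigr => j _.
  rewrite -scaler_suml sum_expr_unity_root; first over.
  by rewrite exprVn -exprM mulnC exprM (prim_expr_order w_prim) expr1n invr1.
rewrite (bigD1 (Ordinal n_gt0)) //= invr1 eqxx big1 ?addr0 => [|j j0].
  by rewrite scalerA mulVf ?scale1r // (prim_root_natf_neq0 w_prim).
rewrite invr_eq1 -(prim_order_dvd w_prim) gtnNdvd ?scale0r ?ltn_ord //.
by rewrite lt0n; apply: contraNneq j0 => j0; apply/eqP/val_inj.
Qed.

End EigenProjections.

(** * Central matrices and matrices with scalar blocks *)

Lemma comm_mx_is_scalar (F : fieldType) k (X : 'M[F]_k.+1) :
  (forall a, X * a = a * X) -> X = (X 0 0)%:M.
Proof.
move=> Xa; apply/matrixP => i j; have /matrixP/(_ i 0) := Xa (delta_mx j 0).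
rewrite !mxE (bigD1 j) //= big1 ?addr0 => [|l lj].
  rewrite (bigD1 0) //= big1 ?addr0 => [|l l0].
    by rewrite !mxE !eqxx mulr1 andbT => ->; rewrite mulr_natl.
  by rewrite !mxE (negPf l0) andbF mul0r.
by rewrite !mxE (negPf lj) mulr0.
Qed.

Lemma eq_ord_divmod N d (i j : 'I_N) :
  (i == j) = (i %/ d == j %/ d)%N && (i %% d == j %% d)%N.
Proof.
apply/idP/andP => [/eqP-> // | [/eqP di /eqP mi]].
by apply/eqP/val_inj; rewrite /= (divn_eq i d) di mi -divn_eq.
Qed.

(** The right factor is written in terms of block number and offset of the row. Writing the
    summation index as s d + q with q < d, only the [q] equal to the offset of the row survives. *)
Lemma scalar_blocks_mul (F : fieldType) n k d p c (f : nat -> nat -> 'I_p -> F) :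
  k.+1 = (n * d)%N ->
  scalar_blocks k d c *m (\matrix_(i < k.+1, j < p) f (i %/ d)%N (i %% d)%N j) =
  \matrix_(i, j) \sum_(s < n) c (i %/ d)%N s * f s (i %% d)%N j.
Proof.
move=> km; have d_gt0 : (0 < d)%N by case: d km => [|//]; rewrite muln0.
apply/matrixP => i j; rewrite !mxE.
under eq_bigr do rewrite !mxE.
have := ltn_pmod i d_gt0; move: (i %/ d)%N (i %% d)%N => r t td.
rewrite -(big_mkord xpredT (fun l => c r (l %/ d)%N * (t == (l %% d)%N)%:R
                                     * f (l %/ d)%N (l %% d)%N j)).
rewrite km big_nat_mul big_mkord; apply: eq_bigr => s _.
rewrite -{1}(add0n (s * d)%N) big_addn mulSn addnK big_mkord.
rewrite (bigD1 (Ordinal td)) //= big1 ?addr0 => [|q /eqP qt].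
  by rewrite addnC divnMDl // divn_small // addn0 modnMDl modn_small // eqxx mulr1.
rewrite addnC modnMDl (modn_small (ltn_ord q)).
case: eqP => [tq|]; last by rewrite mulr0 mul0r.
by case: qt; apply: val_inj.
Qed.

Lemma scalar_blocksM (F : fieldType) n k d (c1 c2 : nat -> nat -> F) :
  k.+1 = (n * d)%N ->
  scalar_blocks k d c1 *m scalar_blocks k d c2 =
  scalar_blocks k d (fun r s => \sum_(q < n) c1 r q * c2 q s).
Proof.
move=> km; pose f q t (j : 'I_k.+1) := c2 q (j %/ d)%N * (t == (j %% d)%N)%:R.
rewrite [LHS](scalar_blocks_mul c1 f km).
apply/matrixP => i j; rewrite !mxE mulr_suml.
by apply: eq_bigr => q _; rewrite mulrA.
Qed.

Lemma eq_scalar_blocks (F : fieldType) n k d (c1 c2 : nat -> nat -> F) :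
  k.+1 = (n * d)%N ->
  (forall r s, (r < n)%N -> (s < n)%N -> c1 r s = c2 r s) ->
  scalar_blocks k d c1 = scalar_blocks k d c2.
Proof.
move=> km c12; apply/matrixP => i j; rewrite !mxE c12 //.
  by rewrite ltn_divLR -?km // lt0n; apply: contra_eq_neq km => ->; rewrite muln0.
by rewrite ltn_divLR -?km // lt0n; apply: contra_eq_neq km => ->; rewrite muln0.
Qed.

Lemma scalar_blocks_scalar (F : fieldType) n k d (a : F) :
  k.+1 = (n * d)%N ->
  scalar_blocks k d (fun r s => if r == s then a else 0) = a%:M.
Proof.
move=> km; apply/matrixP => i j; rewrite !mxE.
rewrite (eq_ord_divmod d).
by case: eqP => _ /=; case: eqP => _; rewrite ?mulr1 ?mul0r ?mulr0.
Qed.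

(** * Relations between the standard matrices *)

Section StandardPair.
Variables (F : fieldType) (n k d : nat) (w : F).
Hypothesis w_prim : n.-primitive_root w.
Hypothesis km : k.+1 = (n * d)%N.

Let n_gt0 : (0 < n)%N. Proof. exact: prim_order_gt0 w_prim. Qed.

(** In block (r, s) the two sides carry w^r and w^(s+1). These agree where [standard_x] is nonzero:
    r = s + 1, or the corner r = 0, s = n - 1, where w^n = 1. *)
Lemma standard_skew alpha :
  standard_g w k d * standard_x n k d alpha =
  w *: (standard_x n k d alpha * standard_g w k d).
Proof.
rewrite -!mulmxE !(scalar_blocksM _ _ km).
have -> c : w *: scalar_blocks k d c = scalar_blocks k d (fun r s => w * c r s).
  by apply/matrixP => i j; rewrite !mxE mulrA.
apply: (eq_scalar_blocks km) => r s rn sn.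
rewrite (bigD1 (Ordinal rn)) //= eqxx big1 ?addr0 => [|q qr]; last first.
  by rewrite ifN ?mul0r //; apply: contraNneq qr => qr; apply/eqP/val_inj.
rewrite (bigD1 (Ordinal sn)) //= eqxx big1 ?addr0 => [|q qr]; last first.
  by rewrite [X in _ * X]ifN ?mulr0 //; apply: contraNneq qr => qr; apply/eqP/val_inj.
case: eqP => [->|_]; first by rewrite mul1r mulr1 exprS.
case: ifP => [/andP[/eqP-> /eqP->]|_]; last by rewrite mul0r !mulr0.
by rewrite expr0 mul1r mulrCA -exprS prednK // (prim_expr_order w_prim) mulr1.
Qed.

Lemma standard_x_exprn (alpha : F) : standard_x n k d alpha ^+ n = alpha%:M.
Proof.
(* The [j]-th power shifts blocks cyclically by [j], with a factor [alpha] on wrapping around; for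
   [j <= n] there is at most one wrap. *)
suff pow j : (j <= n)%N -> standard_x n k d alpha ^+ j = scalar_blocks k d
    (fun r s => if r == (s + j)%N then 1
                else if (r + n == s + j)%N then alpha else 0).
  rewrite pow // -(scalar_blocks_scalar alpha km).
  apply: (eq_scalar_blocks km) => r s rn sn; rewrite ifN ?eqn_add2r //.
  by rewrite ltn_eqF // ltn_addl.
elim: j => [_|j IHj jn].
  rewrite expr0 -[1]/(1%:M) -(scalar_blocks_scalar 1 km).
  apply: (eq_scalar_blocks km) => r s rn sn; rewrite !addn0.
  by case: eqP => // _; rewrite [_ == s]gtn_eqF // ltn_addl.
rewrite exprS IHj 1?ltnW // -mulmxE (scalar_blocksM _ _ km).
apply: (eq_scalar_blocks km) => r s rn sn.
case: r rn => [|r] rn.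
  have n1 : (n.-1 < n)%N by rewrite prednK.
  rewrite (bigD1 (Ordinal n1)) //= big1 ?addr0 => [|q qr]; last first.
    by rewrite ifN ?mul0r //; apply: contraNneq qr => qr; apply/eqP/val_inj.
  rewrite eqxx add0n !addnS /= -(inj_eq succn_inj) prednK //.
  case: eqP => _; first by rewrite mulr1.
  (* A second wrap would need s + j = 2n - 1, whereas s and j are at most n - 1. *)
  rewrite ifN ?mulr0 //; apply/negP => /eqP E.
  have := leq_add sn jn; rewrite addSn addnS -E.
  by rewrite -[X in (_ <= X + _)%N](prednK n_gt0) addSn ltnn.
rewrite (bigD1 (Ordinal (ltnW rn))) //= eqxx big1 ?addr0 => [|q qr]; last first.
  by rewrite eqSS ifN ?mul0r //; apply: contraNneq qr => qr; apply/eqP/val_inj.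
by rewrite mul1r addnS addSn !eqSS.
Qed.

End StandardPair.

(** With the rank factorization E = C B, idempotence reads C (B C) B = C B, where C cancels on the
    left and B on the right. *)
Lemma idem_factor (F : fieldType) m (E : 'M[F]_m) :
  E *m E = E -> col_base E *m row_base E = E /\ row_base E *m col_base E = 1%:M.
Proof.
move=> EE; split; first exact: mulmx_base.
apply: (row_free_inj (row_base_free E)); rewrite mul1mx.
apply: (row_full_inj (col_base_full E)).
by rewrite -mulmxA mulmx_base mulmxA mulmx_base EE.
Qed.

(** * A basis adapted to the eigenspaces *)

Section Frame.
Variables (F : fieldType) (n k e : nat) (X Y E : 'M[F]_k.+1).
Variables (B : 'M[F]_(e.+1, k.+1)) (C : 'M[F]_(k.+1, e.+1)).

(** The blocks of rows are B, B Y, B Y^2, and so on. The number [N] of rows is free because [frameK]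
    is used first for [N = n * e.+1], to prove this equal to [k.+1], and then for [N = k.+1]. *)
Definition frame N : 'M[F]_(N, k.+1) :=
  \matrix_(i, j) (B *m Y ^+ (i %/ e.+1)) (inord (i %% e.+1)) j.
Definition coframe N : 'M[F]_(k.+1, N) :=
  \matrix_(i, j) (X ^+ (j %/ e.+1) *m C) i (inord (j %% e.+1)).

Hypotheses (CB : C *m B = E) (BC : B *m C = 1%:M).
Hypothesis ortho : forall r s, (r < n)%N -> (s < n)%N ->
  E * Y ^+ r * X ^+ s * E = if r == s then E else 0.

(** Block (r, s) of the product is B Y^r X^s C = B (E Y^r X^s E) C, and the middle factor is E or
    0. *)
Lemma frameK N : (N <= n * e.+1)%N -> frame N *m coframe N = 1%:M.
Proof.
move=> Nn; apply/matrixP => i j.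
transitivity ((B *m (E * Y ^+ (i %/ e.+1) * X ^+ (j %/ e.+1) * E) *m C)
                (inord (i %% e.+1)) (inord (j %% e.+1))).
  rewrite -CB -!mulmxE !mulmxA BC mul1mx -(mulmxA _ B) BC mulmx1 -mulmxA.
  rewrite [LHS]mxE [RHS]mxE; apply: eq_bigr => l _.
  by rewrite /frame /coframe; congr (_ * _); rewrite [LHS]mxE.
rewrite [RHS]mxE ortho ?ltn_divLR ?(leq_trans (ltn_ord _) Nn) //.
rewrite (eq_ord_divmod e.+1).
case: eqP => _ /=; last by rewrite mulmx0 mul0mx mxE.
by rewrite -CB !mulmxA BC mul1mx BC mxE -val_eqE /= !inordK ?ltn_pmod.
Qed.

End Frame.

(** * Simultaneous normal form of G and X *)

Section NormalForm.
Variables (F : fieldType) (n k : nat) (w alpha : F).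
Hypothesis w_prim : n.-primitive_root w.
Variables (G X : 'M[F]_k.+1).
Hypotheses (GX : G * X = w *: (X * G)) (X_unit : X \in unitmx).
Hypotheses (Gn : G ^+ n = 1) (Xn : X ^+ n = alpha%:M).

Let n_gt0 : (0 < n)%N. Proof. exact: prim_order_gt0 w_prim. Qed.

Lemma skew_pair_standard :
  exists2 P : 'M[F]_k.+1, P \in unitmx &
    P *m G = standard_g w k (k.+1 %/ n) *m P /\
    P *m X = standard_x n k (k.+1 %/ n) alpha *m P.
Proof.
pose Y := invmx X.
have XY : X * Y = 1 := mulmxV X_unit.
have YX : Y * X = 1 := mulVmx X_unit.
have GE := eigen_proj_mull w_prim Gn.
have EG := eigen_proj_mulr w_prim Gn.
have EE := eigen_proj_idem w_prim Gn.
have sumE := eigen_proj_sum w_prim GX XY.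
have ortho := idem_ortho w_prim GX XY YX GE EG EE.
have skew := idem_skew GX XY YX EG.
move: (eigen_proj n G) GE EG EE sumE ortho skew => E GE EG EE sumE ortho skew.
have [CB BC] := idem_factor EE.
(* The identity is a sum of [n] matrices X^r E Y^r, each of rank at most that of E. *)
have km_le : (k.+1 <= n * \rank E)%N.
  suff: (\rank (1%R : 'M[F]_k.+1) <= n * \rank E)%N by rewrite mxrank1.
  rewrite -sumE -[X in (_ <= X * _)%N]card_ord -sum_nat_const.
  elim/big_ind2: _ => [|A a B b Aa Bb|r _]; first by rewrite mxrank0.
    exact: leq_trans (mxrank_add _ _) (leq_add Aa Bb).
  exact: leq_trans (mxrankM_maxl _ _) (mxrankM_maxr _ _).
move: (\rank E) (col_base E) (row_base E) CB BC km_le => [|e] C B CB BC km_le.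
  by rewrite muln0 in km_le.
have framePK := frameK CB BC ortho.
(* Conversely, the frame with [n * e.+1] rows has a right inverse, so it has at most as many rows as
   columns. *)
have km : k.+1 = (n * e.+1)%N.
  by apply/eqP; rewrite eqn_leq km_le (mulmx1_min (framePK _ (leqnn _))).
have -> : (k.+1 %/ n = e.+1)%N by rewrite km mulKn.
have Pi := framePK k.+1 km_le.
exists (frame Y B k.+1); first by case/mulmx1_unit: Pi.
have BE : B *m E = B by rewrite -CB mulmxA BC mul1mx.
pose f s t j := (B *m Y ^+ s) (inord t) j.
have frameM A : frame Y B k.+1 *m A =
    \matrix_(i, j) (B *m (Y ^+ (i %/ e.+1) * A)) (inord (i %% e.+1)) j.
  apply/matrixP => i j; rewrite [LHS]mxE [RHS]mxE.
  by rewrite -mulmxE mulmxA [RHS]mxE; apply: eq_bigr => l _; rewrite mxE.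
rewrite !frameM; split; rewrite [RHS](scalar_blocks_mul _ f km).
  apply/matrixP => i j; rewrite [LHS]mxE [RHS]mxE.
  have rn : (i %/ e.+1 < n)%N by rewrite ltn_divLR // -km.
  rewrite (bigD1 (Ordinal rn)) //= eqxx big1 ?addr0 => [|q qr]; last first.
    by rewrite ifN ?mul0r //; apply: contraNneq qr => qr; apply/eqP/val_inj.
  by rewrite -BE -mulmxA mulmxE mulrA skew -scalemxAr mxE -mulmxE mulmxA BE.
apply/matrixP => i j; rewrite [LHS]mxE [RHS]mxE.
have : (i %/ e.+1 < n)%N by rewrite ltn_divLR // -km.
move: (i %/ e.+1)%N (i %% e.+1)%N => r t rn.
case: r rn => [|r] rn.
  have n1 : (n.-1 < n)%N by rewrite prednK.
  rewrite (bigD1 (Ordinal n1)) //= big1 ?addr0 => [|q qr]; last first.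
    by rewrite ifN ?mul0r //; apply: contraNneq qr => qr; apply/eqP/val_inj.
  rewrite eqxx mul1r /f.
  (* The first block row of the frame times X must wrap around to the last block B Y^(n-1); this is
     X^n = [alpha] rewritten. *)
  have -> : X = alpha *: Y ^+ n.-1.
    rewrite -mul_scalar_mx -Xn -{1}(prednK n_gt0) exprS mulmxE -mulrA.
    by rewrite mul_exprVr // mulr1.
  by rewrite -scalemxAr mxE.
rewrite (bigD1 (Ordinal (ltnW rn))) //= eqxx big1 ?addr0 => [|q qr]; last first.
  by rewrite eqSS ifN ?mul0r //; apply: contraNneq qr => qr; apply/eqP/val_inj.
by rewrite mul1r /f exprSr -mulrA YX mulr1.
Qed.

End NormalForm.

(** Taking determinants in the skew relation gives w^(k+1) = 1. *)
Lemma skew_pair_dvd (F : fieldType) n k (w : F) (G X : 'M[F]_k.+1) :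
  n.-primitive_root w -> G * X = w *: (X * G) ->
  G \in unitmx -> X \in unitmx -> (n %| k.+1)%N.
Proof.
move=> w_prim GX G_unit X_unit; rewrite (prim_order_dvd w_prim).
have := congr1 determinant GX.
rewrite detZ !det_mulmx -{1}(mul1r (_ * _)) (mulrC (\det X)) => /esym.
by move/(mulIf _) => -> //; rewrite mulf_neq0 // -unitfE.
Qed.

(** * Iterates of the skew derivation *)

Section SkewDerivation.
Variables (F : fieldType) (A : algType F) (w : F) (G G' X : A).
Hypotheses (GX : G * X = w *: (X * G)) (GG' : G * G' = 1) (G'G : G' * G = 1).

Let D (a : A) := X * a - G * a * G' * X.
Let T r (a : A) j := X ^+ j * (G ^+ (r - j) * a * G' ^+ (r - j)) * X ^+ (r - j).

(** Left multiplication by X sends [T r a j] to [T r.+1 a j.+1]. Applying tau and then multiplying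
    by X on the right sends it to w^r [T r.+1 a j], since tau scales the [r] factors X by w each. So
    one more D multiplies the polynomial by 'X - w^r. *)
Lemma iter_skew_derivation r a :
  iter r D a = \sum_(j < r.+1) (\prod_(i < r) ('X - (w ^+ i)%:P))`_j *: T r a j.
Proof.
elim: r => [|r IHr] /=.
  by rewrite big_ord0 big_ord1 coef1 /= /T subnn !expr0 !mulr1 !mul1r scale1r.
have -> : \prod_(i < r.+1) ('X - (w ^+ i)%:P) =
    \prod_(i < r) ('X - (w ^+ i)%:P) * ('X - (w ^+ r)%:P) by rewrite big_ord_recr.
rewrite IHr; set p := \prod_(i < r) _.
have size_p : size p = r.+1.
  by rewrite /p size_prod_XsubC /= -[index_enum _]enumT size_enum_ord.
rewrite mulrBr (eq_bigr (fun j : 'I_r.+2 => (p * 'X)`_j *: T r.+1 a j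
    - (w ^+ r * p`_j) *: T r.+1 a j)) => [|j _]; last first.
  by rewrite coefB coefMC (mulrC _ (w ^+ r)) scalerBl.
(* The product by 'X has no constant term, and the coefficient of [p] at r + 1 vanishes; dropping
   these two terms aligns the sums. *)
rewrite sumrB [X in _ = X - _]big_ord_recl [X in _ = _ - X]big_ord_recr /=.
rewrite coefMX eqxx scale0r add0r.
rewrite [p`_r.+1]nth_default ?size_p // mulr0 scale0r addr0.
rewrite /D mulr_sumr mulr_sumr !mulr_suml; congr (_ - _); apply: eq_bigr => j _.
  by rewrite coefMX /= /T /bump /= add1n subSS -scalerAr !mulrA -exprS.
have jr : (j <= r)%N by rewrite -ltnS.
have conjM x y : G * (x * y) * G' = (G * x * G') * (G * y * G').
  by rewrite !mulrA -(mulrA _ G' G) G'G mulr1.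
have conjX s : G * X ^+ s * G' = w ^+ s *: X ^+ s.
  by rewrite (skew_exprr GX) -scalerAl -mulrA GG' mulr1.
rewrite -scalerAr -!scalerAl -scalerA [RHS]scalerA mulrC -scalerA; congr (_ *: _).
have -> : G * T r a j * G' = w ^+ r *:
    (X ^+ j * (G * (G ^+ (r - j) * a * G' ^+ (r - j)) * G') * X ^+ (r - j)).
  by rewrite /T 2!conjM !conjX -!scalerAl -scalerAr scalerA -exprD subnKC.
rewrite -scalerAl /T subSn //; congr (_ *: _).
rewrite -(mulrA _ (X ^+ _) X) -(exprSr X) (exprS G) (exprSr G').
by rewrite !mulrA.
Qed.

Lemma skew_derivation_nilpotent n a : n.-primitive_root w ->
  iter n D a = X ^+ n * a - G ^+ n * a * G' ^+ n * X ^+ n.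
Proof.
move=> w_prim; rewrite iter_skew_derivation.
rewrite -(big_mkord xpredT (fun i => 'X - (w ^+ i)%:P)) (factor_Xn_sub_1 w_prim).
have := prim_order_gt0 w_prim; case: n w_prim => // n w_prim _.
rewrite big_ord_recl big_ord_recr /= big1 ?add0r => [|j _].
  rewrite !coefB !coefXn !coef1 /= eqxx subr0 sub0r scale1r scaleN1r.
  by rewrite /T subnn subn0 !expr0 !mul1r !mulr1 addrC.
rewrite coefB coefXn coef1 /bump /= add1n eqSS ltn_eqF // subr0 scale0r //.
Qed.

End SkewDerivation.

(** * Transport of inner actions along automorphisms *)

Lemma inner_action_transport (F : fieldType) n (w : F) (A : algType F)
    (act : taft F n -> A -> A) (u : {linear taft F n -> A})
    (phi psi : {lrmorphism A -> A}) :
  cancel phi psi -> cancel psi phi -> inner_action w act u ->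
  inner_action w (fun h a => phi (act h (psi a))) (phi \o u).
Proof.
move=> phiK psiK [act_ok u1 [v uv actE]]; split.
- split=> [a|h|a|h k a|h|h a b].
  + by move=> c h k; rewrite (act_linearl act_ok) linearP.
  + by move=> c a b; rewrite linearP (act_linearr act_ok) linearP.
  + by rewrite (act_one act_ok).
  + by rewrite (act_mul act_ok) phiK.
  + by rewrite rmorph1 (act_unit act_ok) linearZ /= rmorph1.
  + rewrite rmorphM (act_prod act_ok) (sweedler_comp w _ phi).
    by apply: eq_sweedler => p q _; rewrite rmorphM.
- by rewrite /= u1 rmorph1.
exists (phi \o v) => [h|h a].
  have [uvh vuh] := uv h; split.
    transitivity (phi (convolution w u v h)).
      rewrite /convolution sweedler_comp; apply: eq_sweedler => p q _.
      by rewrite /= rmorphM.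
    by rewrite uvh linearZ /= rmorph1.
  transitivity (phi (convolution w v u h)).
    rewrite /convolution sweedler_comp; apply: eq_sweedler => p q _.
    by rewrite /= rmorphM.
  by rewrite vuh linearZ /= rmorph1.
rewrite actE sweedler_comp; apply: eq_sweedler => p q _.
by rewrite /= !rmorphM; congr (_ * _ * _); apply: psiK.
Qed.

Lemma conjmx_lrmorphism (F : fieldType) k (P : 'M[F]_k.+1) : P \in unitmx ->
  exists phi : {lrmorphism 'M[F]_k.+1 -> 'M[F]_k.+1},
    forall a, phi a = P * a * invmx P.
Proof.
move=> P_unit; pose f (a : 'M[F]_k.+1) := P * a * invmx P.
have f_lin : linear f.
  by move=> c a b; rewrite /f mulrDr mulrDl -scalerAr -scalerAl.
have f_mul : monoid_morphism f.
  split=> [|a b]; first by rewrite /f mulr1 -mulmxE mulmxV.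
  by rewrite /f -!mulmxE !mulmxA mulmxKV.
exists (HB.pack f (GRing.isLinear.Build _ _ _ _ f f_lin)
  (GRing.isMonoidMorphism.Build _ _ f f_mul) : {lrmorphism _ -> _}).
by [].
Qed.

(** From D^n = 0 one gets X^n a = G^n a G^-n X^n; with G^n scalar this says that X^n is central,
    hence scalar. *)
Lemma inner_action_ux_exprn (F : fieldType) n k (w : F)
    (act : taft F n -> 'M[F]_k.+1 -> 'M[F]_k.+1)
    (u : {linear taft F n -> 'M[F]_k.+1}) (b : F) :
  (1 < n)%N -> n.-primitive_root w -> inner_action w act u ->
  u taft_g * u taft_x = w *: (u taft_x * u taft_g) ->
  u taft_g ^+ n = b%:M -> exists alpha, u taft_x ^+ n = alpha%:M.
Proof.
case: n act u => [|[|n]] // act u _ w_prim u_inner GX Gn.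
have [act_ok _ _] := u_inner.
have [gi [Ggi giG] [_ actx]] := inner_action_gx u_inner.
eexists; apply: comm_mx_is_scalar => a.
have /eqP := action_iter_x a act_ok.
rewrite (eq_iter actx) (skew_derivation_nilpotent GX Ggi giG) // subr_eq0 => /eqP ->.
have -> : u taft_g ^+ n.+2 * a = a * u taft_g ^+ n.+2.
  by rewrite Gn -!mulmxE scalar_mxC.
by rewrite -(mulrA a) mul_exprVr // mulr1.
Qed.

(** For Z = X1 - X2, the choice b = G gives Z G = G Z. Together with G Z = w Z G and [w != 1] this
    forces G Z = 0. *)
Lemma skew_derivation_inj (F : fieldType) (A : algType F) (w : F) (G G' X1 X2 : A) :
  w != 1 -> G * G' = 1 -> G' * G = 1 ->
  G * X1 = w *: (X1 * G) -> G * X2 = w *: (X2 * G) ->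
  (forall b, X1 * b - G * b * G' * X1 = X2 * b - G * b * G' * X2) -> X1 = X2.
Proof.
move=> w1 GG' G'G GX1 GX2 X12; apply/eqP; rewrite -subr_eq0; set Z := X1 - X2.
have ZG : Z * G = G * Z.
  have := X12 G; rewrite -(mulrA G G G') GG' mulr1 mulrBl mulrBr => X12G.
  by rewrite (canRL (subrK _) X12G) addrAC (addrAC (X2 * G)) subrr add0r addrC.
have : (w - 1) *: (G * Z) = 0.
  by rewrite scalerBl scale1r -{1}ZG mulrBl mulrBr GX1 GX2 scalerBr subrr.
move/eqP; rewrite scaler_eq0 subr_eq0 (negPf w1) => /eqP GZ.
by rewrite -[Z]mul1r -G'G -mulrA GZ mulr0.
Qed.

(** * Invariance of the parameter under isomorphism *)

Lemma standard_action_iso (F : fieldType) n k (w alpha beta : F)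
    (act1 act2 : taft F n -> 'M[F]_k.+1 -> 'M[F]_k.+1) :
  (1 < n)%N -> n.-primitive_root w -> (n %| k.+1)%N ->
  standard_action w (k.+1 %/ n) alpha act1 ->
  standard_action w (k.+1 %/ n) beta act2 ->
  action_iso act1 act2 -> alpha = beta.
Proof.
case: n act1 act2 => [|[|n]] // act1 act2 _ w_prim n_dvd.
have km : k.+1 = (n.+2 * (k.+1 %/ n.+2))%N by rewrite mulnC divnK.
move: (k.+1 %/ n.+2)%N km => d km [u1 [inn1 u1g u1x]] [u2 [inn2 u2g u2x]].
case=> phi [[psi phiK psiK] phi_act].
have [g1 [Gg1 g1G] [act1g act1x]] := inner_action_gx inn1.
have [g2 [Gg2 g2G] [act2g act2x]] := inner_action_gx inn2.
rewrite !u1g !u1x in Gg1 g1G act1g act1x; rewrite !u2g !u2x in Gg2 g2G act2g act2x.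
set G := standard_g w k d in Gg1 g1G act1g act1x Gg2 g2G act2g act2x.
set X1 := standard_x n.+2 k d alpha in act1x.
set X2 := standard_x n.+2 k d beta in act2x.
have GX1 : G * X1 = w *: (X1 * G) := standard_skew w_prim km alpha.
have GX2 : G * X2 = w *: (X2 * G) := standard_skew w_prim km beta.
(* The isomorphism intertwines conjugation by G with itself, which suffices without computing
   [phi G]. *)
have conjE b : G * b * g2 = phi (G * psi b * g1).
  by have := phi_act taft_g (psi b); rewrite act2g act1g psiK.
have w1 : w != 1.
  by rewrite -[w]expr1 -(prim_order_dvd w_prim).
have eqX : phi X1 = X2.
  apply: (skew_derivation_inj w1 Gg2 g2G) => // [|b].
    have := conjE (phi X1); rewrite phiK GX1 -scalerAl -(mulrA X1) Gg1 mulr1.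
    rewrite linearZ /= => /(congr1 (fun z => z * G)).
    by rewrite -mulrA g2G mulr1 -scalerAl.
  have := phi_act taft_x (psi b).
  rewrite act2x act1x psiK => ->.
  have -> : phi (X1 * psi b - G * psi b * g1 * X1) =
      phi X1 * phi (psi b) - phi (G * psi b * g1) * phi X1 by rewrite rmorphB !rmorphM.
  by rewrite -conjE psiK.
have : phi (X1 ^+ n.+2) = X2 ^+ n.+2 by rewrite rmorphXn /= eqX.
rewrite !(standard_x_exprn w_prim km) -scalemx1 linearZ /= rmorph1 scalemx1.
by move/matrixP/(_ 0 0); rewrite !mxE.
Qed.

(** * Reduction of an inner action to the standard one *)

Lemma inner_action_standard (F : fieldType) n k (w c : F)
    (act : taft F n -> 'M[F]_k.+1 -> 'M[F]_k.+1)
    (u : {linear taft F n -> 'M[F]_k.+1}) :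
  (1 < n)%N -> n.-primitive_root w -> inner_action w act u ->
  u taft_g * u taft_x = w *: (u taft_x * u taft_g) -> u taft_x \in unitmx ->
  u taft_g ^+ n = (c ^+ n)%:M ->
  exists alpha : F, alpha != 0 /\
    exists act', standard_action w (k.+1 %/ n) alpha act' /\ action_iso act act'.
Proof.
move=> n_gt1 w_prim u_inner GX X_unit Gn.
have [alpha Xn] := inner_action_ux_exprn n_gt1 w_prim u_inner GX Gn.
case: n act u n_gt1 w_prim u_inner GX X_unit Gn Xn => [|[|n]] // act u _.
move=> w_prim u_inner GX X_unit Gn Xn.
have [gi [Ggi _] _] := inner_action_gx u_inner.
have c_neq0 : c != 0.
  apply/eqP => c0; have := mul_exprVr n.+2 Ggi.
  rewrite Gn c0 expr0n /= raddf0 mul0r => /esym/eqP.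
  by rewrite oner_eq0.
exists alpha; split.
  apply/eqP => a0; have : u taft_x ^+ n.+2 \is a GRing.unit by rewrite unitrX.
  by rewrite Xn a0 raddf0 unitr0.
pose G1 := c^-1 *: u taft_g.
have GX1 : G1 * u taft_x = w *: (u taft_x * G1).
  by rewrite -scalerAl GX -scalerAr !scalerA mulrC.
have Gn1 : G1 ^+ n.+2 = 1.
  by rewrite exprZn Gn scale_scalar_mx exprVn mulVf // expf_neq0.
have [P P_unit [PG PX]] := skew_pair_standard w_prim GX1 X_unit Gn1 Xn.
have [phi phiE] := conjmx_lrmorphism P_unit.
have [psi psiE] : exists psi : {lrmorphism 'M[F]_k.+1 -> 'M[F]_k.+1},
    forall a, psi a = invmx P * a * P.
  have [psi psiE] := conjmx_lrmorphism (P := invmx P) (etrans (unitmx_inv P) P_unit).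
  by exists psi => a; rewrite psiE invmxK.
have phiK : cancel phi psi.
  by move=> a; rewrite phiE psiE -!mulmxE -!mulmxA mulKmx // mulVmx // mulmx1.
have psiK : cancel psi phi.
  by move=> a; rewrite phiE psiE -!mulmxE -!mulmxA mulKVmx // mulmxV // mulmx1.
(* The action transported by conjugation with P is implemented by [phi \o twist u c]: the twist
   scales u(g) by c^-1 and fixes u(x), and conjugation by P makes both standard. *)
exists (fun h a => phi (act h (psi a))); split; last first.
  by exists phi; split; [exists psi | move=> h a; rewrite phiK].
exists (phi \o twist u c); split.
- exact/inner_action_transport/inner_action_twist.
- rewrite /= (_ : twist u c taft_g = G1) ?phiE -?mulmxE ?PG ?mulmxK //.
  by rewrite [LHS]twist_mon // expr1.
- rewrite /= (_ : twist u c taft_x = u taft_x) ?phiE -?mulmxE ?PX ?mulmxK //.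
  by rewrite [LHS]twist_mon // expr0 invr1 scale1r.
Qed.

(* The matrix algebra is M_m(F) with m = k+1. In any inner action u(g)^n is a  *)
(* scalar; the normal form exists only if that scalar is an n-th power in F,  *)
(* which is automatic over an algebraically closed field. Over the rationals, *)
(* u(g) = [[0, -1], [1, 0]] and u(x) = diag(1, -1), with n = m = 2, define an *)
(* inner action isomorphic to no normal form.                                 *)
Theorem theorem6p1 (F : fieldType) (n k : nat) (w : F)
    (n_ge2 : (2 <= n)%N) (w_prim : n.-primitive_root w)
    (act : taft F n -> 'M[F]_k.+1 -> 'M[F]_k.+1)
    (u : {linear taft F n -> 'M[F]_k.+1})
    (u_inner : inner_action w act u)
    (u_comm : u taft_g * u taft_x = w *: (u taft_x * u taft_g))
    (ux_unit : u taft_x \in unitmx) :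
  let d := (k.+1 %/ n)%N in
  [/\ (n %| k.+1)%N,
      (exists c : F, u taft_g ^+ n = (c ^+ n)%:M) ->
        exists alpha : F, alpha != 0 /\
          exists act' : taft F n -> 'M[F]_k.+1 -> 'M[F]_k.+1,
            standard_action w d alpha act' /\ action_iso act act'
    & forall (alpha beta : F)
        (act1 act2 : taft F n -> 'M[F]_k.+1 -> 'M[F]_k.+1),
        alpha != 0 -> beta != 0 -> alpha != beta ->
        standard_action w d alpha act1 -> standard_action w d beta act2 ->
        ~ action_iso act1 act2].
Proof.
(* The determinant argument for divisibility needs [u taft_g] invertible, which the convolution
   inverse at g provides. *)
move=> d; have [gi Ggi] : exists gi, u taft_g * gi = 1.
  case: (n) n_ge2 (act) (u) u_inner => [|[|n']] // _ act' u' u'_inner.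
  by have [gi [Ggi _] _] := inner_action_gx u'_inner; exists gi.
have n_dvd : (n %| k.+1)%N.
  by apply: skew_pair_dvd w_prim u_comm _ ux_unit; case/mulmx1_unit: Ggi.
split=> // [[c Gn]|alpha beta act1 act2 _ _ /eqP ab std1 std2 iso12].
  exact: inner_action_standard u_inner u_comm ux_unit Gn.
exact/ab/(standard_action_iso _ _ _ std1 std2 iso12).
Qed.
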